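(* Let $n'\geqslant 1$ be an integer and $n=3n'$. Then for every integer $r\in\{n-1-p_{\max}(n'),\ldots,n-1\}$ there exists an $r$-regular maximal $(2,3)$-antichain on $n$ points.
   Context: Let $[n]=\{1,2,\ldots,n\}$. A maximal $(2,3)$-antichain on $n$ points is a family $\mathcal{A}=\mathcal{A}_2\cup\mathcal{A}_3$ with $\mathcal{A}_2\subseteq\binom{[n]}{2}$ (2-element subsets) and $\mathcal{A}_3\subseteq\binom{[n]}{3}$ (3-element subsets) such that (1) no member of $\mathcal{A}$ is a subset of another member of $\mathcal{A}$, and (2) for every $X\in 2^{[n]}\setminus\mathcal{A}$ there is an $A\in\mathcal{A}$ with $X\subseteq A$ or $A\subseteq X$. It is $r$-regular if every element of $[n]$ is contained in exactly $r$ members of $\mathcal{A}$. For a positive integer $n'$, $p_{\max}(n')$ denotes the maximal $p$ for which there exist an abelian group $\Gamma$ (written additively) of order $|\Gamma|=n'$ and sequences $A=(a_1,\ldots,a_p)$ and $B=(b_1,\ldots,b_p)$ of elements of $\Gamma$ such that: (i) $a_i\neq a_j$ and $b_i\neq b_j$ for $i\neq j$; (ii) the sequence $C=(b_1-a_1,\ldots,b_p-a_p)$ has pairwise distinct entries, i.e. $b_i-a_i\neq b_j-a_j$ for $i\neq j$; (iii) $b_j-a_i$ is not an entry of $C$ for all $i\neq j$. *)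

(* Defs.v *)
From mathcomp Require Import all_boot all_algebra.
From mathcomp Require Import boolp.

Set Implicit Arguments.
Unset Strict Implicit.
Unset Printing Implicit Defensive.

Import GRing.Theory.

(* The family is the union of its members of size 2 and of size 3; either part
   may be empty. *)
Record maximal_23_antichain (n : nat) (F : {set {set 'I_n}}) : Prop := {
  size_23 : forall X, X \in F -> (#|X| == 2) || (#|X| == 3);
  incomparable : forall X Y, X \in F -> Y \in F -> X != Y -> ~~ (X \subset Y);
  saturated : forall X, X \notin F ->
    exists2 Y, Y \in F & (X \subset Y) || (Y \subset X)
}.

Definition regular (n r : nat) (F : {set {set 'I_n}}) : Prop :=
  forall x : 'I_n, #|[set X in F | x \in X]| = r.

Section DifferenceSystem.
Local Open Scope ring_scope.

Record good_sequences (G : zmodType) (p : nat) (a b : 'I_p -> G) : Prop := {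
  good_injl : forall i j, i != j -> a i != a j;
  good_injr : forall i j, i != j -> b i != b j;
  good_injd : forall i j, i != j -> b i - a i != b j - a j;
  good_cross : forall i j, i != j -> forall k, b j - a i != b k - a k
}.

End DifferenceSystem.

Definition attainable (m p : nat) : Prop :=
  exists (G : finZmodType) (a b : 'I_p -> G),
    #|G| = m /\ good_sequences a b.

(* Restricting to p <= m loses nothing, since the entries of a are distinct;
   p_max_ge and p_max_attained show that for m > 0 this is the maximum over
   all p. *)
Definition p_max (m : nat) : nat := \max_(p < m.+1 | `[< attainable m p >]) p.

Lemma attainable_leq m p : attainable m p -> p <= m.
Proof.
move=> [G [a [b [<- [inj_a _ _ _]]]]].
rewrite -[p in p <= _]card_ord; apply: (leq_card a) => i j eq_a.
by apply/eqP; apply: contraT => /inj_a; rewrite eq_a eqxx.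
Qed.

Lemma p_max_ge m p : attainable m p -> p <= p_max m.
Proof.
move=> att; have lt_pm : p < m.+1 by rewrite ltnS attainable_leq.
by apply: (leq_bigmax_cond (Ordinal lt_pm)); apply/asboolP.
Qed.

Lemma p_max_attained m : 0 < m -> attainable m (p_max m).
Proof.
case: m => // m _.
have att0 : attainable m.+1 0.
  exists 'I_m.+1, (fun=> ord0), (fun=> ord0).
  by split; [rewrite card_ord | split=> -[]].
have c_gt0 : 0 < #|[pred p : 'I_m.+2 | `[< attainable m.+1 p >]]|.
  by apply/card_gt0P; exists ord0; apply/asboolP.
have [i /asboolP att def_i] := eq_bigmax_cond (@nat_of_ord m.+2) c_gt0.
by have -> : p_max m.+1 = i.
Qed.

(* Main.v *)
Require Import Defs.
From mathcomp Require Import all_boot all_algebra.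

(** A maximal (2,3)-antichain amounts to a graph in which every edge lies in a
    triangle: its members are the triangles and the non-edges. If the graph is
    the union of edge-disjoint triangles, has no further triangles, and every
    vertex lies in s of them, then every vertex has 2s neighbours, hence lies
    in n - 1 - 2s non-edges and s triangles, and the antichain is
    (n - 1 - s)-regular. Given sequences a, b in a group G of order n' and
    s <= p_max n', such triangles on three copies of G are
    {(0, g), (1, g + a_i), (2, g + b_i)} for g in G and i < s. Distinctness of
    the a_i, the b_i and the b_i - a_i makes them edge-disjoint, and the
    condition on the b_j - a_i excludes further triangles. *)

Import GRing.Theory.

(** * Antichains from systems of edge-disjoint triangles *)

Section TriangleSystem.

Context (T : finType) (s : nat) (Bs : {set {set T}}).

Hypothesis block_size : forall B, B \in Bs -> #|B| = 3.
Hypothesis block_linear : forall B C x y, B \in Bs -> C \in Bs -> x != y ->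
  x \in B -> y \in B -> x \in C -> y \in C -> B = C.
Hypothesis block_triangle : forall X : {set T}, #|X| = 3 ->
  (forall x y, x \in X -> y \in X -> x != y ->
    exists2 B, B \in Bs & (x \in B) && (y \in B)) -> X \in Bs.
Hypothesis block_degree : forall x, #|[set B in Bs | x \in B]| = s.

Definition covered (P : {set T}) := [exists B in Bs, P \subset B].

Definition uncovered_pairs := [set P : {set T} | (#|P| == 2) && ~~ covered P].

Definition block_antichain := Bs :|: uncovered_pairs.

Lemma covered2P x y :
  reflect (exists2 B, B \in Bs & (x \in B) && (y \in B)) (covered [set x; y]).
Proof.
apply: (iffP exists_inP) => -[B BB].
  by rewrite subUset !sub1set => ?; exists B.
by move=> ?; exists B => //; rewrite subUset !sub1set.
Qed.

Lemma block_antichain_size X :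
  X \in block_antichain -> (#|X| == 2) || (#|X| == 3).
Proof.
by rewrite !inE => /orP[/block_size-> //|/andP[-> _]].
Qed.

(** Sizes rule out every proper inclusion except that of a pair in a block, and such a pair would be
    covered. *)
Lemma block_antichain_incomparable X Y :
  X \in block_antichain -> Y \in block_antichain -> X != Y ->
  ~~ (X \subset Y).
Proof.
move=> XF YF; apply: contraNN => sXY.
rewrite eqEcard sXY /=; move: XF YF.
rewrite !inE => /orP[BX|/andP[/eqP-> ncX]] /orP[BY|/andP[/eqP cY ncY]].
- by rewrite !block_size.
- by have := subset_leq_card sXY; rewrite block_size // cY.
- by case/exists_inP: ncX; exists Y.
- by rewrite cY.
Qed.

Lemma superset_card2 (X : {set T}) : 1 < #|T| -> #|X| <= 2 ->
  exists x y, x != y /\ X \subset [set x; y].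
Proof.
move=> T_gt1 X_le2.
have [X2|] := ltnP 1 #|X|.
  have /cards2P[x [y [nxy ->]]] : #|X| == 2 by rewrite eqn_leq X_le2.
  by exists x, y.
have /card_gt1P[u [v [_ _ nuv]]] : 1 < #|[set: T]| by rewrite cardsT.
rewrite leq_eqVlt ltnS leqn0 cards_eq0 => /orP[/cards1P[x ->]|/eqP->].
  have [xu|nxu] := eqVneq x u.
    by exists u, v; rewrite xu sub1set !inE eqxx.
  by exists x, u; rewrite sub1set !inE eqxx.
by exists u, v; rewrite sub0set.
Qed.

(** A set of at most two points extends to a pair, which is a member or lies in a block. A larger
    set contains a triple, which either has an uncovered pair or is a block by [block_triangle]. *)
Lemma block_antichain_saturated (X : {set T}) : 1 < #|T| ->
  exists2 Y, Y \in block_antichain & (X \subset Y) || (Y \subset X).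
Proof.
move=> T_gt1.
have [/(superset_card2 _ T_gt1)[x [y [nxy sX]]]|X_gt2] := leqP #|X| 2.
  have [/exists_inP[B BB sB]|ncov] := boolP (covered [set x; y]).
    by exists B; rewrite ?inE ?BB // (subset_trans sX sB).
  by exists [set x; y]; rewrite ?sX // !inE cards2 nxy ncov orbT.
have [x [y [z [[xX yX zX] [nxy nyz nzx]]]]] := card_gt2P X_gt2.
pose Y := [set x; y; z].
have sYX : Y \subset X by rewrite !subUset !sub1set xX yX.
have cY : #|Y| = 3.
  by rewrite /Y setUC cardsU1 cards2 !inE nxy negb_or nzx eq_sym nyz.
have [|allc] := boolP [exists u in Y, exists v in Y,
    (u != v) && ~~ covered [set u; v]]; last first.
  exists Y; last by rewrite sYX orbT.
  rewrite inE block_triangle // => u v uY vY nuv; apply/covered2P.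
  apply: contraNT allc => ncov; apply/exists_inP; exists u => //.
  by apply/exists_inP; exists v; rewrite ?nuv.
case/exists_inP => u uY /exists_inP[v vY /andP[nuv ncov]].
exists [set u; v]; first by rewrite !inE cards2 nuv ncov orbT.
by rewrite orbC (subset_trans _ sYX) // subUset !sub1set uY.
Qed.

Lemma card_covered_neighbours x :
  #|[set y | (y != x) && covered [set x; y]]| = 2 * s.
Proof.
rewrite -sum1_card.
(* Double counting of the [y != x] and blocks through both: by [block_linear] a neighbour [y] lies
   in one such block, and each of the [s] blocks at [x] has two choices of [y]. *)
have -> : \sum_(y in [set y | (y != x) && covered [set x; y]]) 1 =
    \sum_(y | y != x) \sum_(B in Bs | x \in B) (y \in B : nat).
  rewrite [LHS](eq_bigl (fun y => (y != x) && covered [set x; y])); last first.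
    by move=> y; rewrite inE.
  rewrite big_mkcondr; apply: eq_bigr => y nyx.
  case: covered2P => [[B BB /andP[xB yB]]|ncov].
    rewrite (bigD1 B) ?BB //= yB big1 // => C /andP[/andP[BC xC] nCB].
    have [yC|//] := boolP (y \in C).
    by case/eqP: nCB; apply: (block_linear _ _ _ _ BC BB nyx).
  rewrite big1 // => B /andP[BB xB].
  by have [yB|//] := boolP (y \in B); case: ncov; exists B; rewrite ?xB.
rewrite exchange_big /= mulnC -(block_degree x) -sum_nat_const.
rewrite [RHS](eq_bigl (fun B => (B \in Bs) && (x \in B))); last first.
  by move=> B; rewrite inE.
apply: eq_bigr => B /andP[BB xB].
have := cardsD1 x B; rewrite block_size // xB add1n => -[->].
rewrite -sum1_card [RHS](eq_bigl (fun y => (y != x) && (y \in B))); last first.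
  by move=> y; rewrite !inE.
by rewrite [RHS]big_mkcondr; apply: eq_bigr => y _; case: (y \in B).
Qed.

Lemma card_uncovered_pairs x :
  #|[set P in uncovered_pairs | x \in P]| + 2 * s = #|T|.-1.
Proof.
pose N := [set y | (y != x) && ~~ covered [set x; y]].
(* An uncovered pair at [x] is determined by its other point, a non-neighbour of [x]. *)
have -> : [set P in uncovered_pairs | x \in P] = [set [set x; y] | y in N].
  apply/setP => P; rewrite !inE; apply/andP/imsetP => [[]|[y]].
    case/andP => /cards2P[u [v [nuv ->]]] ncov; rewrite !inE.
    case/orP => /eqP xE; subst x; first by exists v; rewrite // inE eq_sym nuv.
    by exists u; [rewrite inE nuv setUC | rewrite setUC].
  by rewrite inE => /andP[nyx ncov] ->; rewrite cards2 [x == y]eq_sym nyx ncov !inE eqxx.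
rewrite card_in_imset; last first.
  move=> y z; rewrite !inE => /andP[nyx _] /andP[nzx _] /setP/(_ y).
  by rewrite !inE eqxx orbT (negbTE nyx) => /esym/eqP.
rewrite -(card_covered_neighbours x) -(cardsC1 x).
rewrite -(cardsID [set y | covered [set x; y]] [set~ x]) addnC.
by congr addn; apply: eq_card => y; rewrite !inE // andbC.
Qed.

Lemma block_antichain_degree x :
  #|[set X in block_antichain | x \in X]| = #|T|.-1 - s.
Proof.
have -> : [set X in block_antichain | x \in X] =
    [set B in Bs | x \in B] :|: [set P in uncovered_pairs | x \in P].
  by apply/setP => X; rewrite !inE andb_orl.
rewrite cardsU block_degree.
have -> : [set B in Bs | x \in B] :&: [set P in uncovered_pairs | x \in P] =
    set0.
  apply/setP => X; rewrite !inE; apply/negP.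
  by case/andP => /andP[/block_size->].
by rewrite cards0 subn0 -(card_uncovered_pairs x) mul2n -addnn addnA addnK addnC.
Qed.

End TriangleSystem.

(** * Triangle systems from good sequences in a group *)

Lemma subrDl {V : zmodType} (z x y : V) : (z + x - (z + y) = x - y)%R.
Proof. by rewrite [(z + x)%R]addrC addrKA. Qed.

Section GroupTriangles.

Local Open Scope ring_scope.

Context (G : finZmodType) (s : nat) (a b : 'I_s -> G).
Hypothesis good : good_sequences a b.
Context (T : finType) (f : T -> 'I_3 * G) (f_bij : bijective f).

Definition shift (l : 'I_3) (i : 'I_s) : G :=
  if l == 0 :> nat then 0 else if l == 1 :> nat then a i else b i.

(** For [k < l] the differences are [a i], [b i] and [b i - a i], so this unifies the three
    distinctness conditions; swapping [k] and [l] only changes signs. *)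
Lemma shift_diff_inj k l : k != l ->
  injective (fun i => shift l i - shift k i).
Proof.
have wlog_lt (k' l' : 'I_3) : (k' < l')%N ->
    injective (fun i => shift l' i - shift k' i).
  move=> lt_kl i j /= eq_ij; apply/eqP; apply: contraT => nij.
  move: eq_ij; case: good => /(_ i j nij) na /(_ i j nij) nb /(_ i j nij) nd _.
  case: k' l' lt_kl => -[|[|[|//]]] ? [[|[|[|//]]] ?] // _;
    rewrite /shift /= ?subr0 => /eqP.
  - by rewrite (negbTE na).
  - by rewrite (negbTE nb).
  - by rewrite (negbTE nd).
rewrite -val_eqE neq_ltn => /orP[|lt_lk i j /= eq_ij]; first exact: wlog_lt.
by apply: (wlog_lt _ _ lt_lk); rewrite -opprB eq_ij opprB.
Qed.

(** Points are labelled through [f], so that [T] can later be ['I_n] itself. *)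
Definition triangle (q : G * 'I_s) : {set T} :=
  [set x | (f x).2 == q.1 + shift (f x).1 q.2].

Definition triangles := [set triangle q | q : G * 'I_s].

Lemma triangle_card q : #|triangle q| = 3%N.
Proof.
case: f_bij => f' fK f'K.
have -> : triangle q = [set f' (l, q.1 + shift l q.2) | l : 'I_3].
  apply/setP => x; rewrite inE; apply/eqP/imsetP => [eq_x|[l _ ->]].
    by exists (f x).1; rewrite // -eq_x -surjective_pairing fK.
  by rewrite f'K.
rewrite card_imset ?card_ord // => k l /(can_inj f'K).
by case.
Qed.

Lemma triangle_part_inj q x y :
  x \in triangle q -> y \in triangle q -> (f x).1 = (f y).1 -> x = y.
Proof.
rewrite !inE => /eqP vx /eqP vy eq_k; apply: (bij_inj f_bij).
by rewrite [LHS]surjective_pairing [RHS]surjective_pairing vx vy eq_k.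
Qed.

(** The two points lie in different copies of [G]. The difference of their coordinates fixes the
    index by [shift_diff_inj], and then one coordinate fixes the translation. *)
Lemma triangle_linear q q' x y : x != y ->
  x \in triangle q -> y \in triangle q ->
  x \in triangle q' -> y \in triangle q' -> q = q'.
Proof.
move=> nxy xq yq; have nk : (f x).1 != (f y).1.
  by apply: contraNN nxy => /eqP/(triangle_part_inj _ _ _ xq yq)/eqP.
move: xq yq; case: q q' => g i [h j]; rewrite !inE /=.
move=> /eqP xi /eqP yi /eqP xj /eqP yj.
have eq_ij : i = j.
  apply: (shift_diff_inj _ _ nk) => /=.
  rewrite -(subrDl g) -[RHS](subrDl h).
  by rewrite -xi -yi -xj -yj.
by subst j; congr (_, _); apply: (addIr (shift (f x).1 i)); rewrite -xi -xj.
Qed.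

Lemma triangle_inj : injective triangle.
Proof.
move=> q q' eq_q.
have /card_gt1P[x [y [xq yq nxy]]] : (1 < #|triangle q|)%N by rewrite triangle_card.
by apply: (triangle_linear _ _ _ _ nxy xq yq); rewrite -eq_q.
Qed.

Lemma triangles_degree x : #|[set B in triangles | x \in B]| = s.
Proof.
have -> : [set B in triangles | x \in B] =
    (* For each index [i], exactly one translate passes through [x]. *)
    [set triangle ((f x).2 - shift (f x).1 i, i) | i : 'I_s].
  apply/setP => B; rewrite inE; apply/andP/imsetP => [[]|[i _ ->]].
    case/imsetP => -[g i] _ ->; rewrite inE /= => /eqP vx.
    by exists i; rewrite // vx addrK.
  by rewrite imset_f // inE /= subrK.
by rewrite card_imset ?card_ord // => i j /triangle_inj[].
Qed.

Lemma triangles_triangle (X : {set T}) : #|X| = 3%N ->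
  (forall x y, x \in X -> y \in X -> x != y ->
    exists2 B, B \in triangles & (x \in B) && (y \in B)) -> X \in triangles.
Proof.
move=> X3 cov.
(* A triangle meets each copy of [G] once, so covered pairs join different copies and [X] has one
   point in each. *)
have part_inj : {in X &, injective (fun x => (f x).1)}.
  move=> x y xX yX eq_k; apply/eqP; apply: contraT => nxy.
  have [_ /imsetP[q _ ->] /andP[xq yq]] := cov x y xX yX nxy.
  by case/eqP: nxy; apply: (triangle_part_inj _ _ _ xq yq).
have full : [set (f x).1 | x in X] = [set: 'I_3].
  by apply/eqP; rewrite eqEcard subsetT cardsT card_ord card_in_imset ?X3.
have vertex l : exists2 x, x \in X & (f x).1 = l.
  have : l \in [set (f x).1 | x in X] by rewrite full inE.
  by case/imsetP => x xX ->; exists x.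
pose l1 : 'I_3 := inord 1; pose l2 : 'I_3 := inord 2.
have [x xX kx] := vertex ord0; have [y yX ky] := vertex l1.
have [z zX kz] := vertex l2.
have edge u v : u \in X -> v \in X -> (f u).1 != (f v).1 ->
    exists g i, (f u).2 = g + shift (f u).1 i /\ (f v).2 = g + shift (f v).1 i.
  move=> uX vX nuv.
  have [|_ /imsetP[[g i] _ ->]] := cov u v uX vX.
    by apply: contraNN nuv => /eqP->.
  by rewrite !inE => /andP[/eqP ? /eqP ?]; exists g, i.
have [|g [i]] := edge x y xX yX; first by rewrite kx ky -val_eqE /= inordK.
have [|h [j]] := edge x z xX zX; first by rewrite kx kz -val_eqE /= inordK.
have [|u [k]] := edge y z yX zX.
  by rewrite ky kz -val_eqE /= !inordK.
rewrite kx ky kz /shift /= !inordK //= !addr0 => -[y_k z_k] [x_h z_j] [x_g y_i].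
rewrite -x_h x_g in z_j.
have eq_ij : i = j.
  apply/eqP; apply: contraT => nij.
  (* The three edges come from triangles with indices [i], [j], [k]; computing the coordinate
     difference of [z] and [y] in two ways gives [b j - a i = b k - a k]. *)
  have /eqP[] := good_cross good nij k.
  rewrite -(subrDl g) -[RHS](subrDl u).
  by rewrite -z_j -y_i -z_k -y_k.
subst j; suff -> : X = triangle (g, i) by rewrite imset_f.
apply/eqP; rewrite eqEcard triangle_card X3 leqnn andbT.
apply/subsetP => w wX; rewrite inE /=.
have : (f w).1 \in [set ord0; l1; l2].
  rewrite !inE -!val_eqE /= !inordK //.
  by case: (f w).1 => -[|[|[|//]]].
rewrite !inE => /orP[/orP[]|] /eqP kw.
- by rewrite (part_inj w x) ?kw ?kx // /shift /= addr0 x_g.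
- by rewrite (part_inj w y) ?kw ?ky // /shift /= inordK //= y_i.
- by rewrite (part_inj w z) ?kw ?kz // /shift /= inordK //= z_j.
Qed.

End GroupTriangles.

(** * Choice of the sequence length and transfer to ['I_n] *)

Lemma attainable_antitone m p s : s <= p -> attainable m p -> attainable m s.
Proof.
move=> le_sp [G [a [b [cG [na nb nd nc]]]]].
pose w := widen_ord le_sp.
exists G, (a \o w), (b \o w); split=> //.
by split=> i j nij *; [apply: na | apply: nb | apply: nd | apply: nc].
Qed.

Theorem theorem6 (n' : nat) (hn' : 1 <= n') (n : nat) (hn : n = 3 * n')
    (r : nat) (hr : n - 1 - p_max n' <= r <= n - 1) :
  exists F : {set {set 'I_n}}, maximal_23_antichain F /\ regular r F.
Proof.
have /andP[r_ge r_le] := hr.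
(* The degree [n - 1 - s] has to be [r], hence [s = n - 1 - r]. The lower bound on [r] gives
   [s <= p_max n'], so sequences of maximal length can be truncated. *)
have att : attainable n' (n - 1 - r).
  apply: attainable_antitone (p_max_attained hn').
  by rewrite leq_subCl.
have [G [a [b [cG good]]]] := att.
have cT : #|'I_n| = #|{: 'I_3 * G}| by rewrite card_prod !card_ord cG.
pose f x : 'I_3 * G := enum_val (cast_ord cT (enum_rank x)).
have f_bij : bijective f.
  exists (fun q => enum_val (cast_ord (esym cT) (enum_rank q))) => q.
    by rewrite /f enum_valK cast_ordK enum_rankK.
  by rewrite /f enum_valK cast_ordKV enum_rankK.
have size3 B : B \in triangles G _ a b _ f -> #|B| = 3.
  by case/imsetP => q _ ->; apply: triangle_card.
have linear B C x y : B \in triangles G _ a b _ f ->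
    C \in triangles G _ a b _ f -> x != y ->
    x \in B -> y \in B -> x \in C -> y \in C -> B = C.
  move=> /imsetP[q _ ->] /imsetP[q' _ ->] nxy xq yq xq' yq'.
  by congr triangle; apply: (triangle_linear _ _ _ _ good _ _ f_bij) nxy _ _ _ _.
have n_gt1 : 1 < #|'I_n|.
  by rewrite card_ord hn (leq_trans _ (leq_pmulr 3 hn')).
exists (block_antichain _ (triangles G _ a b _ f)); split; last first.
  move=> x; rewrite (block_antichain_degree _ (n - 1 - r)) //.
    (* The upper bound [r <= n - 1] makes the truncated subtraction [n - 1 - (n - 1 - r)] equal to
       [r]. *)
    by rewrite card_ord -subn1 subKn.
  exact: triangles_degree.
split=> [X|X Y|X _].
- exact: block_antichain_size.
- exact: block_antichain_incomparable.
- by apply: block_antichain_saturated => //; apply: triangles_triangle.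
Qed.
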